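(* Let $G$ be a group. Fix a commutative (pre-)ordered monoid $\langle M,+,\prec\rangle$ with minimal element $0$ and satisfying the following property: if $s\prec u$ and $u=\sum_{i=1}^d u_i$ (with $u_i\in M$), then there exist $s_i\in M$ with $s_i\prec u_i$ for each $i$ and $s=\sum_{i=1}^d s_i$. Fix a set $X$ of generators for $M$ such that for every $x\in X$ and $y\in M$, if $y\prec x$ then $y\in X$. If $\pi:X\to 2^G$ maps into the normal subgroups of $G$ and for every $s,u\in X$, $s\prec u$ implies $\pi_u\leq \pi_s$, then the function $\bar\pi:M\to 2^G$ defined by $$\bar\pi_s=\prod_{(s_1,\dots,s_d)}[\pi_{s_1},\dots,\pi_{s_d}]\qquad (s\in M),$$ where the product runs over all finite sequences $(s_1,\dots,s_d)$ of elements of $X$ with $s=s_1+\cdots+s_d$ (equivalently, over all finite directed paths from $0$ to $s$ in the Cayley graph of $M$ with respect to $X$, recorded by their edge labels), is a (pre-)ordered filter on $G$.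
   Context: Here $2^G$ is the power set of $G$, and for a function $\pi$ into $2^G$ we write $\pi_s$ for its value at $s$. For $x,y\in G$, $[x,y]=x^{-1}y^{-1}xy$; for $A,B\subseteq G$, $[A,B]=\langle [x,y]:x\in A,\ y\in B\rangle$. For subgroups $A_i$, $[A_1]=A_1$ and $[A_1,\dots,A_{m+1}]=[[A_1,\dots,A_m],A_{m+1}]$. The Cayley graph of $M$ with respect to $X$ has vertex set $M$ and a directed edge labeled $x$ from $s$ to $s+x$ for each $s\in M$ and $x\in X$. Every commutative monoid $M$ has a natural pre-order (reflexive and transitive relation) $\prec$, defined by $s\prec u$ if there is $t\in M$ with $s+t=u$. An ordered monoid is a commutative monoid with a partial order $\leq$ such that whenever $s\leq t$ and $u\leq v$, then also $s+u\leq t+v$. ''(Pre-)ordered'' is to be read in two parallel versions: in the pre-ordered version $\prec$ is the natural pre-order of $M$ and the conclusion is that $\bar\pi$ is a pre-ordered filter; in the ordered version $\prec$ is the partial order of an ordered monoid and the conclusion is that $\bar\pi$ is an ordered filter. A filter on $G$ (over a commutative monoid $M$), also called a pre-ordered filter, is a function $\phi:M\to 2^G$ such that every $\phi_s$ is a subgroup of $G$, $G=\phi_0$, and for all $s,t\in M$, $[\phi_s,\phi_t]\leq \phi_{s+t}\leq \phi_s\cap\phi_t$. A filter $\phi:M\to 2^G$ is ordered if $M$ is an ordered monoid, with partial order $\leq$, and $s\leq t$ implies $\phi_s\geq \phi_t$. *)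

(* Defs.v *)
From mathcomp Require Import all_boot ssralg.
From mathcomp Require Import boolp classical_sets.

Set Implicit Arguments.
Unset Strict Implicit.
Unset Printing Implicit Defensive.

Local Open Scope group_scope.
Local Open Scope classical_set_scope.

(* Groups are MathComp's possibly infinite [groupType]s, and the power set of
   [G] is [set G].  As in MathComp, [x ^ y = y^-1 * x * y] and
   [[~ x, y] = x^-1 * y^-1 * x * y]. *)

Section Groups.
Variable G : groupType.
Implicit Types (A B H : set G).

Definition is_subgroup H : Prop := group_closed (mem H).

Definition is_normal_subgroup H : Prop :=
  is_subgroup H /\ forall x g, H x -> H (x ^ g).

Definition generated_subgroup A : set G := smallest is_subgroup A.

Definition set_commutator A B : set G :=
  generated_subgroup [set z | exists x y, [/\ A x, B y & z = [~ x, y]]].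

(* [A_1, ..., A_m], left-normed.  The empty commutator is the whole group:
   without this convention the filter induced by a function would not take
   the value [G] at [0]. *)
Definition iterated_commutator (l : seq (set G)) : set G :=
  if l is A :: l' then foldl set_commutator A l' else setT.

(* The product of the (possibly infinite) family of the [H i] for [i] in [P]:
   all finite products of elements of members of the family.  Nothing here
   makes it a subgroup; the empty product gives [1]. *)
Definition set_product (I : Type) (P : set I) (H : I -> set G) : set G :=
  [set g | exists2 r : seq G,
     forall x, x \in r -> (\bigcup_(i in P) H i) x & g = \prod_(x <- r) x].

End Groups.

Local Open Scope ring_scope.

Section Monoids.
Variable M : nmodType.
Implicit Types (prec : M -> M -> Prop) (X : set M).

Definition natural_preorder (s u : M) : Prop := exists t : M, s + t = u.

Record is_partial_order prec : Prop := {
  prec_refl : forall s, prec s s;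
  prec_trans : forall s t u, prec s t -> prec t u -> prec s u;
  prec_antisym : forall s t, prec s t -> prec t s -> s = t }.

Definition is_ordered_monoid prec : Prop :=
  is_partial_order prec /\
  forall s t u v, prec s t -> prec u v -> prec (s + u) (t + v).

(* Minimality of [0] means that [0] lies below everything (which always holds
   for the natural pre-order). *)
Definition zero_minimal prec : Prop := forall s, prec 0 s.

(* The number [d] of summands may be [0], as for the finite sequences indexing
   [induced_filter].  The case [d = 0] says that [prec s 0] implies [s = 0]:
   this follows from [zero_minimal] for a partial order, and for the natural
   pre-order it says that no nonzero element of [M] has an opposite. *)
Definition has_refinement prec : Prop :=
  forall (s u : M) (d : nat) (u_ : 'I_d -> M),
    prec s u -> u = \sum_(i < d) u_ i ->
    exists s_ : 'I_d -> M,
      (forall i, prec (s_ i) (u_ i)) /\ s = \sum_(i < d) s_ i.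

Definition is_submonoid (N : set M) : Prop := GRing.nmod_closed (mem N).

Definition generates X : Prop := smallest is_submonoid X = setT.

Definition downward_closed prec X : Prop :=
  forall x y, X x -> prec y x -> X y.

End Monoids.

Section Filters.
Variables (G : groupType) (M : nmodType).
Implicit Types phi : M -> set G.

Record is_group_filter phi : Prop := {
  group_filter_subgroup : forall s, is_subgroup (phi s);
  group_filter0 : phi 0 = setT;
  group_filter_comm :
    forall s t, set_commutator (phi s) (phi t) `<=` phi (s + t);
  group_filter_cap : forall s t, phi (s + t) `<=` phi s `&` phi t }.

Definition is_ordered_group_filter (prec : M -> M -> Prop) phi : Prop :=
  [/\ is_group_filter phi, is_ordered_monoid prec &
      forall s t, prec s t -> phi t `<=` phi s].

(* [seq X] is the type of finite sequences of elements of [X], the empty one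
   (the trivial path from [0] to [0] in the Cayley graph) included. *)
Definition induced_filter (X : set M) (pi : X -> set G) (s : M) : set G :=
  set_product [set l : seq X | s = \sum_(x <- l) val x]
    (fun l => iterated_commutator [seq pi x | x <- l]).

End Filters.

(* Main.v *)
Require Import Defs.
From mathcomp Require Import all_boot ssralg.
From mathcomp Require Import boolp classical_sets.

Local Open Scope classical_set_scope.

(** Write [A_l] for the iterated commutator of the values of [pi] along a path
    [l], so that the value of the induced filter at [s] is the product of the
    normal subgroups [A_l] over the paths [l] from [0] to [s].

    The commutator condition follows from its special case: if [l] and [k] are
    paths with sums [s] and [t], then [[A_l, A_k]] lies in the filter at
    [s + t] ([commg_iterated_commutators]).  The special case suffices because
    a commutator condition modulo a normal subgroup passes from a family of
    subgroups to its product, in each argument separately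
    ([commg_set_productl], [commg_set_productr]).  The special case is proved by
    induction on [k].  If [k] extends a nonempty path [k'] by an edge [x], then
    [A_k = [A_k', pi x]], and the three subgroups lemma, modulo the normal
    subgroup that the filter takes at [s + t], reduces the claim to
    [[[A_l, A_k'], pi x]] and [[[A_l, pi x], A_k']].  In the first one the inner
    commutator lies in a value of the filter by induction, and taking
    commutators with [pi x] extends every path by the edge [x].  In the second
    one the inner commutator lies in the iterated commutator of [l] extended by
    [x], and the induction hypothesis applies to this longer [l] and the shorter
    [k'].

    The filter reverses the order because the refinement property replaces a
    path to [u] by a path to [s] whose edges are smaller one by one, hence carry
    larger subgroups, and iterated commutators are monotone
    ([induced_filter_anti]).  The inclusion of the value at [s + t] in the
    values at [s] and at [t] is the case of the pairs [s], [s + t] and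
    [t], [s + t]. *)

(** * Subgroups and commutators *)

Section Commutators.
Local Open Scope group_scope.
Variable G : groupType.
Implicit Types (A B C H N : set G) (x y z a b c : G).

Lemma is_subgroupP H :
  is_subgroup H <-> H 1 /\ forall x y, H x -> H y -> H (x / y).
Proof.
split=> -[H1 HD].
  split=> [|x y Hx Hy]; first by apply/set_mem.
  by apply/set_mem; apply: HD; apply/mem_set.
by split=> [|x y /set_mem Hx /set_mem Hy]; apply/mem_set => //; apply: HD.
Qed.

Lemma subgroup1 H : is_subgroup H -> H 1.
Proof. by case/is_subgroupP. Qed.

Lemma subgroupV H x : is_subgroup H -> H x -> H x^-1.
Proof. by case/is_subgroupP=> H1 HD Hx; rewrite -div1g; apply: HD. Qed.

Lemma subgroupM H x y : is_subgroup H -> H x -> H y -> H (x * y).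
Proof.
move=> sgH Hx Hy; rewrite -[y]invgK.
by case/is_subgroupP: (sgH) => _; apply=> //; apply: subgroupV.
Qed.

Lemma subgroup_intro H : H 1 -> (forall x y, H x -> H y -> H (x * y)) ->
  (forall x, H x -> H x^-1) -> is_subgroup H.
Proof.
by move=> H1 HM HV; apply/is_subgroupP; split=> // x y Hx /HV; apply: HM.
Qed.

Lemma generated_subgroup_subgroup A : is_subgroup (generated_subgroup A).
Proof.
apply/is_subgroupP; split=> [H [sgH _]|x y Ax Ay H HA]; first exact: subgroup1.
by case/is_subgroupP: (HA.1) => _; apply; [apply: Ax | apply: Ay].
Qed.

Lemma normal_subgroupT : is_normal_subgroup [set: G].
Proof. by split=> //; apply/is_subgroupP. Qed.

Lemma mem_set_commutator A B a b : A a -> B b -> set_commutator A B [~ a, b].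
Proof. by move=> Aa Bb; apply: sub_gen_smallest; exists a, b. Qed.

Lemma set_commutator_subgroup A B : is_subgroup (set_commutator A B).
Proof. exact: generated_subgroup_subgroup. Qed.

Lemma set_commutator_sub A B N : is_subgroup N ->
  (forall a b, A a -> B b -> N [~ a, b]) -> set_commutator A B `<=` N.
Proof.
move=> sgN sABN; apply: smallest_sub => // _ [a [b [? ? ->]]].
exact: sABN.
Qed.

Lemma set_commutatorS A B A' B' : A `<=` A' -> B `<=` B' ->
  set_commutator A B `<=` set_commutator A' B'.
Proof.
move=> sA sB; apply: set_commutator_sub; first exact: set_commutator_subgroup.
by move=> a b /sA ? /sB ?; apply: mem_set_commutator.
Qed.

Lemma normal_set_commutator A B : is_normal_subgroup A ->
  is_normal_subgroup B -> is_normal_subgroup (set_commutator A B).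
Proof.
move=> [_ nA] [_ nB]; have sgAB := set_commutator_subgroup A B.
split=> // x g; move: x; apply: set_commutator_sub => [|a b Aa Bb] /=.
  apply: subgroup_intro => [|x y Jx Jy|x Jx]; rewrite /= ?conj1g ?conjMg ?conjVg.
  - exact: subgroup1 sgAB.
  - exact: subgroupM sgAB Jx Jy.
  - exact: subgroupV sgAB Jx.
by rewrite conjRg; apply: mem_set_commutator; [apply: nA | apply: nB].
Qed.

Lemma commg_normalr N a b : is_normal_subgroup N -> N b -> N [~ a, b].
Proof.
move=> [sgN nN] Nb; rewrite commgEr.
by apply: subgroupM => //; apply: nN; apply: subgroupV.
Qed.

(** The elements that centralize [B] modulo [N].  Since they form a subgroup, a
    condition on commutators need only be checked on generators. *)
Definition centralizer_mod N B : set G := [set a | forall b, B b -> N [~ a, b]].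

Lemma centralizer_mod_subgroup N B :
  is_normal_subgroup N -> is_subgroup (centralizer_mod N B).
Proof.
move=> [sgN nN]; apply: subgroup_intro => [b _|x y Cx Cy b Bb|x Cx b Bb].
- by rewrite comm1g; apply: subgroup1.
- have -> : [~ x * y, b] = [~ x, b] ^ y * [~ y, b].
    by rewrite /commg /conjg !invgM !mulgA !mulgK.
  by apply: subgroupM => //; [apply: nN; apply: Cx | apply: Cy].
- have -> : [~ x^-1, b] = [~ x, b]^-1 ^ x^-1.
    by rewrite /commg /conjg !invgM !invgK !mulgA mulgK.
  by apply: nN; apply: subgroupV => //; apply: Cx.
Qed.

Lemma Hall_Witt_identity x y z :
  [~ x, y^-1, z] ^ y * [~ y, z^-1, x] ^ z * [~ z, x^-1, y] ^ x = 1.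
Proof.
rewrite /commg /conjg !(invgM, invgK) !mulgA.
by rewrite !(mulgK, mulgVK, mulVg, mulgV, mul1g, mulg1).
Qed.

Lemma Hall_Witt_mem N x y z : is_normal_subgroup N ->
  N [~ x, y^-1, z] -> N [~ z, x^-1, y] -> N [~ y, z^-1, x].
Proof.
move=> [sgN nN] Nxyz Nzxy; rewrite -(conjgK z [~ y, z^-1, x]).
apply: (nN); have := Hall_Witt_identity x y z.
move: ([~ y, z^-1, x] ^ z) (nN _ y Nxyz) (nN _ x Nzxy) => v.
move: ([~ x, y^-1, z] ^ y) ([~ z, x^-1, y] ^ x) => u w Nu Nw uvw1.
have -> : v = u^-1 * (u * v * w) * w^-1 by rewrite -!mulgA mulgV mulg1 mulKg.
by rewrite uvw1 mulg1; apply: subgroupM => //; apply: subgroupV.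
Qed.

(** The three subgroups lemma modulo a normal subgroup; the Hall-Witt identity
    turns memberships for two of the three cyclic arrangements into one for
    the third. *)
Lemma three_subgroups A B C N : is_normal_subgroup N ->
  is_subgroup A -> is_subgroup B -> is_subgroup C ->
  (forall w c, set_commutator A B w -> C c -> N [~ w, c]) ->
  (forall w b, set_commutator A C w -> B b -> N [~ w, b]) ->
  forall a w, A a -> set_commutator B C w -> N [~ a, w].
Proof.
move=> nN sgA sgB sgC NABC NACB a w Aa BCw.
have [sgN cN] := nN; rewrite -invgR; apply: subgroupV => //.
suff sBC : set_commutator B C `<=` centralizer_mod N A by exact: sBC BCw a Aa.
apply: set_commutator_sub; first exact: centralizer_mod_subgroup.
move=> b c Bb Cc a' Aa'.
rewrite -[c]invgK; apply: Hall_Witt_mem => //.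
  apply: NABC; last exact: subgroupV.
  by apply: mem_set_commutator => //; apply: subgroupV.
apply: NACB => //; rewrite -invgR.
apply: (subgroupV _ _ (set_commutator_subgroup A C)).
by apply: mem_set_commutator; apply: subgroupV.
Qed.

(** * Products of families of subgroups *)

Section SetProduct.
Variables (I : Type) (P : set I) (H : I -> set G).

Lemma set_product_sup i : P i -> H i `<=` set_product P H.
Proof.
move=> Pi x Hx; exists [:: x]; last by rewrite big_seq1.
by move=> y; rewrite inE => /eqP->; exists i.
Qed.

Lemma set_product_sub N : is_subgroup N ->
  (forall i, P i -> H i `<=` N) -> set_product P H `<=` N.
Proof.
move=> sgN sHN _ [r Hr ->]; rewrite big_seq; elim/big_ind: _ => [|x y|x xr].
- exact: subgroup1.
- exact: subgroupM.
- by have [i Pi Hx] := Hr x xr; apply: sHN Hx.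
Qed.

Lemma normal_set_product : (forall i, P i -> is_normal_subgroup (H i)) ->
  is_normal_subgroup (set_product P H).
Proof.
move=> nH; have prodM x y :
    set_product P H x -> set_product P H y -> set_product P H (x * y).
  move=> [r Hr ->] [q Hq ->]; exists (r ++ q); last by rewrite big_cat.
  by move=> z; rewrite mem_cat => /orP[/Hr|/Hq].
have prod1 : set_product P H 1 by exists [::]; rewrite ?big_nil.
split=> [|x g [r Hr ->]].
  apply: subgroup_intro => // x [r + ->].
  elim: r => [|y r IHr] Hr; first by rewrite big_nil invg1.
  rewrite big_cons invgM; apply: prodM.
    by apply: IHr => z zr; apply: Hr; rewrite inE zr orbT.
  have [i Pi Hy] := Hr y (mem_head y r).
  by apply: (set_product_sup i) => //; apply: subgroupV => //; case: (nH i Pi).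
rewrite conjg_prod big_seq; elim/big_ind: _ => // y yr.
have [i Pi Hy] := Hr y yr.
by apply: (set_product_sup i) => //; case: (nH i Pi) => _; apply.
Qed.

Lemma commg_set_productl N B a b : is_normal_subgroup N ->
  (forall i a b, P i -> H i a -> B b -> N [~ a, b]) ->
  set_product P H a -> B b -> N [~ a, b].
Proof.
move=> nN NHB Ha; move: a Ha b.
apply: set_product_sub; first exact: centralizer_mod_subgroup.
by move=> i Pi a Ha b; apply: NHB Ha.
Qed.

Lemma commg_set_productr N B a b : is_normal_subgroup N ->
  (forall i a b, P i -> B a -> H i b -> N [~ a, b]) ->
  B a -> set_product P H b -> N [~ a, b].
Proof.
move=> nN NBH Ba Hb; have [sgN _] := nN.
rewrite -invgR; apply: subgroupV => //; apply: commg_set_productl Hb Ba => //.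
by move=> i c d Pi Hc Bd; rewrite -invgR; apply: subgroupV => //; apply: NBH Hc.
Qed.

End SetProduct.

(** * Iterated commutators *)

Section IteratedCommutators.
Variables (I : Type) (H : I -> set G).
Implicit Types (r : seq I) (i : I).

Lemma iterated_commutator_rcons r i : r <> [::] ->
  iterated_commutator [seq H j | j <- rcons r i] =
  set_commutator (iterated_commutator [seq H j | j <- r]) (H i).
Proof. by case: r => // j r _; rewrite map_rcons /= foldl_rcons. Qed.

Lemma normal_iterated_commutator r : (forall i, is_normal_subgroup (H i)) ->
  is_normal_subgroup (iterated_commutator [seq H i | i <- r]).
Proof.
move=> nH; elim/last_ind: r => [|r i IHr]; first exact: normal_subgroupT.
case: r IHr => [_|j r IHr]; first exact: nH.
by rewrite iterated_commutator_rcons //; apply: normal_set_commutator.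
Qed.

(** Only an inclusion, because the empty iterated commutator is [G], while
    [[G, H i]] is in general smaller than [H i]. *)
Lemma commg_iterated_commutator_rcons r i a b : is_normal_subgroup (H i) ->
  iterated_commutator [seq H j | j <- r] a -> H i b ->
  iterated_commutator [seq H j | j <- rcons r i] [~ a, b].
Proof.
case: r => [|j r] nH ra Hb; first exact: commg_normalr.
by rewrite iterated_commutator_rcons //; apply: mem_set_commutator.
Qed.

Lemma iterated_commutatorS (K : I -> set G) r : (forall i, H i `<=` K i) ->
  iterated_commutator [seq H i | i <- r] `<=`
  iterated_commutator [seq K i | i <- r].
Proof.
case: r => // j r sHK /=; elim: r (H j) (K j) (sHK j) => //= i r IHr A B sAB.
by apply: IHr; apply: set_commutatorS.
Qed.

End IteratedCommutators.
End Commutators.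

(** * The induced filter *)

Section InducedFilter.
Import GRing.Theory.
Local Open Scope ring_scope.
Variables (G : groupType) (M : nmodType) (X : set M) (pi : X -> set G).

Let path_sum (l : seq X) : M := \sum_(x <- l) val x.
Let path_comm (l : seq X) : set G := iterated_commutator [seq pi x | x <- l].

Lemma path_comm_sub_induced_filter l :
  path_comm l `<=` induced_filter pi (path_sum l).
Proof. exact: set_product_sup. Qed.

Lemma induced_filter0 : induced_filter pi 0 = setT.
Proof.
apply/seteqP; split=> // g _.
by have := @path_comm_sub_induced_filter [::] g I; rewrite /path_sum big_nil.
Qed.

Section NormalValues.
Hypothesis pi_normal : forall x : X, is_normal_subgroup (pi x).

Lemma normal_path_comm l : is_normal_subgroup (path_comm l).
Proof. exact: normal_iterated_commutator. Qed.

Lemma normal_induced_filter s : is_normal_subgroup (induced_filter pi s).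
Proof. by apply: normal_set_product => l _; apply: normal_path_comm. Qed.

Lemma commg_induced_filter_gen s (x : X) g h :
  induced_filter pi s g -> pi x h -> induced_filter pi (s + val x) [~ g, h]%g.
Proof.
apply: commg_set_productl; first exact: normal_induced_filter.
move=> l a b -> la pib.
have -> : \sum_(y <- l) val y + val x = path_sum (rcons l x).
  by rewrite /path_sum -cats1 big_cat big_seq1.
by apply: path_comm_sub_induced_filter; apply: commg_iterated_commutator_rcons.
Qed.

(** The induction is on [k] with [l] general, because the second half of the
    three subgroups lemma moves the last edge of [k] to the end of [l]. *)
Lemma commg_iterated_commutators k l a b : path_comm l a -> path_comm k b ->
  induced_filter pi (path_sum l + path_sum k) [~ a, b]%g.
Proof.
elim/last_ind: k l a b => [|k x IHk] l a b la.
  move=> _; rewrite {2}/path_sum big_nil addr0 -invgR.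
  have [sgF _] := normal_induced_filter (path_sum l); apply: subgroupV => //.
  apply: path_comm_sub_induced_filter.
  by apply: commg_normalr => //; apply: normal_path_comm.
have path_sum_rcons m : path_sum (rcons m x) = path_sum m + val x.
  by rewrite /path_sum -cats1 big_cat big_seq1.
have [->|kN0] := eqVneq k [::].
  move=> pib; rewrite {2}/path_sum big_seq1 -path_sum_rcons.
  apply: path_comm_sub_induced_filter.
  exact: commg_iterated_commutator_rcons.
rewrite {1}/path_comm iterated_commutator_rcons; last exact/eqP.
have nF := normal_induced_filter (path_sum l + path_sum (rcons k x)).
have [sgl _] := normal_path_comm l; have [sgk _] := normal_path_comm k.
have [sgx _] := pi_normal x; move=> kb.
apply: (three_subgroups _ _ _ _ _ nF sgl sgk sgx) la kb => w c lw.
  rewrite path_sum_rcons addrA; apply: commg_induced_filter_gen.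
  apply: set_commutator_sub lw; last exact: IHk.
  by case: (normal_induced_filter (path_sum l + path_sum k)).
rewrite path_sum_rcons (addrC _ (val x)) addrA -path_sum_rcons; apply: IHk.
apply: set_commutator_sub lw; first by case: (normal_path_comm (rcons l x)).
by move=> d e ld xe; apply: commg_iterated_commutator_rcons.
Qed.

Lemma set_commutator_induced_filter s t :
  set_commutator (induced_filter pi s) (induced_filter pi t) `<=`
  induced_filter pi (s + t).
Proof.
have nF := normal_induced_filter (s + t).
apply: set_commutator_sub => [|a b]; first by case: nF.
apply: commg_set_productl => // l c d def_s lc; apply: commg_set_productr lc => //.
move=> k e f def_t le kf; rewrite def_s def_t.
exact: commg_iterated_commutators.
Qed.

Lemma is_group_filter_induced :
  (forall s t, induced_filter pi (s + t) `<=` induced_filter pi s) ->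
  is_group_filter (induced_filter pi).
Proof.
move=> Fadd; split=> [s||//|s t]; last 1 first.
- by move=> g Fg; split; apply: Fadd; [|rewrite addrC]; apply: Fg.
- by case: (normal_induced_filter s).
- exact: induced_filter0.
- exact: set_commutator_induced_filter.
Qed.

End NormalValues.

(** Downward closure of [X] makes the summands given by the refinement property
    into the edges of a path to [s]. *)
Lemma induced_filter_anti (prec : M -> M -> Prop) s u :
  has_refinement prec -> downward_closed prec X ->
  (forall x y : X, prec (val x) (val y) -> pi y `<=` pi x) ->
  (forall x : X, is_normal_subgroup (pi x)) ->
  prec s u -> induced_filter pi u `<=` induced_filter pi s.
Proof.
move=> refine downX pi_anti pi_normal le_su.
apply: set_product_sub => [|l /= def_u].
  by case: (normal_induced_filter pi_normal s).
(* Both paths are indexed by the same ordinals, so that they can be compared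
   edge by edge. *)
have l_enum : l = [seq tnth (in_tuple l) i | i <- enum 'I_(size l)].
  by rewrite -[LHS]/(tval (in_tuple l)) {1}(tuple_map_ord (in_tuple l)).
have [s_ [le_s_ def_s]] := refine s u (size l) (fun i => val (tnth (in_tuple l) i))
  le_su (etrans def_u (big_tnth _ _ _ _ _)).
have Xs_ i : X (s_ i) := downX _ _ (set_valP (tnth (in_tuple l) i)) (le_s_ i).
pose l' := [seq SigSub (mem_set (Xs_ i)) : X | i <- enum 'I_(size l)].
have -> : s = path_sum l' by rewrite def_s /path_sum big_map big_enum.
apply: subset_trans (@path_comm_sub_induced_filter l').
rewrite [in X in X `<=` _]l_enum /path_comm /l' -!map_comp.
by apply: iterated_commutatorS => i; apply: pi_anti; apply: le_s_.
Qed.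

End InducedFilter.

Theorem theorem3p11 (G : groupType) (M : nmodType) (prec : M -> M -> Prop)
    (X : set M) (pi : X -> set G) :
  zero_minimal prec ->
  has_refinement prec ->
  generates X ->
  downward_closed prec X ->
  (forall x : X, is_normal_subgroup (pi x)) ->
  (forall s u : X, prec (val s) (val u) -> pi u `<=` pi s) ->
  ((forall s u : M, prec s u <-> natural_preorder s u) ->
     is_group_filter (induced_filter pi)) /\
  (is_ordered_monoid prec ->
     is_ordered_group_filter prec (induced_filter pi)).
Proof.
move=> prec0 refine _ downX pi_normal pi_anti.
have anti s u : prec s u -> induced_filter pi u `<=` induced_filter pi s.
  exact: induced_filter_anti.
split=> [precE|ordM].
  apply: is_group_filter_induced => // s t.
  by apply: anti; apply/precE; exists t.
split=> //; apply: is_group_filter_induced => // s t; apply: anti.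
(* Compatibility of the order with addition turns [0 <= t] into [s <= s + t]. *)
have [[refl_prec _ _] precD] := ordM.
by have := precD s s 0%R t (refl_prec s) (prec0 t); rewrite GRing.addr0.
Qed.
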